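(* Let $(X,\leq,\wedge)$ be an $\omega_1$-like lower semi-lattice. Then there is a $*$-lower semi-lattice $\mathcal{T}\subseteq\mathscr{P}(\omega)$ such that $(\mathcal{T},\subseteq^* )$ is order-isomorphic to $(X,\leq)$ and $|G(\mathcal{T})|=2^{\omega_1}$.
   Context: $A\subseteq^*B$ means $A\setminus B$ is finite; $A=^*B$ means $A\subseteq^*B$ and $B\subseteq^*A$. A lower semi-lattice is a partial order in which every two elements $x,y$ have an infimum $x\wedge y$. It is $\omega_1$-like if it is well-founded, of size $\omega_1$, and $\{y:y<x\}$ is countable for each $x$. A family $\mathcal{T}\subseteq\mathscr{P}(\omega)$ is a $*$-lower semi-lattice if for any $A,B\in\mathcal{T}$ there is $C\in\mathcal{T}$ with $A\cap B=^*C$. A coherent subsystem of $\mathcal{T}$ is a function $g:\mathcal{T}\to\mathscr{P}(\omega)$ with $g(A)\subseteq A$ for all $A$, and $g(A)\cap B=^*g(B)$ whenever $B\subseteq^*A$; it is trivial if some $C\subseteq\omega$ satisfies $C\cap A=^*g(A)$ for all $A\in\mathcal{T}$. $C(\mathcal{T})$ is the set of coherent subsystems, a group under $(f\cdot g)(A)=f(A)\triangle g(A)$, and $Tr(\mathcal{T})$ its subgroup of trivial ones; the gap cohomology group is $G(\mathcal{T})=C(\mathcal{T})/Tr(\mathcal{T})$. *)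

(* Defs.v *)
From mathcomp Require Import all_boot.
From mathcomp Require Import boolp classical_sets cardinality.
Set Implicit Arguments. Unset Strict Implicit. Unset Printing Implicit Defensive.
Local Open Scope classical_set_scope.

Definition subE (A B : set nat) : Prop := finite_set (A `\` B).
Definition eqE (A B : set nat) : Prop := subE A B /\ subE B A.
Definition symdiff (A B : set nat) : set nat := (A `\` B) `|` (B `\` A).

Definition partial_order (X : Type) (le : X -> X -> Prop) : Prop :=
  (forall x, le x x) /\
  (forall x y, le x y -> le y x -> x = y) /\
  (forall x y z, le x y -> le y z -> le x z).

Definition lower_semilattice (X : Type) (le : X -> X -> Prop) : Prop :=
  partial_order le /\
  forall x y, exists m, le m x /\ le m y /\
    (forall z, le z x -> le z y -> le z m).

Definition strict (X : Type) (le : X -> X -> Prop) (x y : X) : Prop :=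
  le x y /\ x <> y.

Definition is_omega1 (W : Type) (lt : W -> W -> Prop) : Prop :=
  (forall w, ~ lt w w) /\
  (forall u v w, lt u v -> lt v w -> lt u w) /\
  (forall u v, lt u v \/ u = v \/ lt v u) /\
  well_founded lt /\
  ~ countable [set: W] /\
  (forall w, countable [set v | lt v w]).

Definition omega1_like (X : Type) (le : X -> X -> Prop) : Prop :=
  well_founded (strict le) /\
  (exists (W : Type) (lt : W -> W -> Prop) (f : X -> W),
      is_omega1 lt /\ bijective f) /\
  (forall x, countable [set y | strict le y x]).

Definition star_lsl (T : set (set nat)) : Prop :=
  forall A B, T A -> T B -> exists C, T C /\ eqE (A `&` B) C.

Definition memT (T : set (set nat)) : Type := {A : set nat | T A}.

Definition order_iso_to (X : Type) (le : X -> X -> Prop) (T : set (set nat))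
  : Prop :=
  exists f : X -> memT T, bijective f /\
    forall x y, le x y <-> subE (proj1_sig (f x)) (proj1_sig (f y)).

Definition subsys (T : set (set nat)) : Type := memT T -> set nat.

Definition coherent (T : set (set nat)) (g : subsys T) : Prop :=
  (forall A : memT T, g A `<=` proj1_sig A) /\
  (forall A B : memT T, subE (proj1_sig B) (proj1_sig A) ->
     eqE (g A `&` proj1_sig B) (g B)).

Definition trivial_sys (T : set (set nat)) (g : subsys T) : Prop :=
  exists C : set nat, forall A : memT T, eqE (C `&` proj1_sig A) (g A).

(* group operation of C(T): (f . g)(A) = f(A) Δ g(A); every element is its own
   inverse, so f and g have the same coset mod Tr(T) iff f . g is trivial. *)
Definition sys_mul (T : set (set nat)) (f g : subsys T) : subsys T :=
  fun A => symdiff (f A) (g A).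

Definition coset_of (T : set (set nat)) (g : subsys T) : set (subsys T) :=
  [set h | coherent h /\ trivial_sys (sys_mul g h)].

(* G(T) = C(T)/Tr(T), as the type of cosets g.Tr(T), g in C(T) *)
Definition GT (T : set (set nat)) : Type :=
  {S : set (subsys T) | exists g, coherent g /\ S = coset_of g}.

(* Main.v *)
Require Import Defs.
From mathcomp Require Import all_boot.
From mathcomp Require Import boolp classical_sets cardinality.
From mathcomp Require Import functions.

(** Transport the semi-lattice to a well-order [W] of type omega_1.  Take
    forest orders [R n] on [W] with finite initial segments, increasing with
    [n], whose union is the well-order; they play the role of the relations
    "rho(a, b) <= n" for a finite-to-one, almost ultrametric
    [rho : [omega_1]^2 -> omega].  Let [c n] be injective on every [R n]-chain
    and let [delta x] bound [{y | y <= x}] in [W].  The sets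
    [A x = {(m, c m y) | R m y (delta x), y <= x}] satisfy
    [A x /\ A y =* A (x /\ y)], because for large [m] all the nodes concerned
    lie on one [R m]-chain, where [c m] identifies them.

    If some uncountable [U] has, in each of its uncountable subsets, infinitely
    many members below a common [x], then for [V] included in [U] let [g V x]
    consist of the points [(rho y, c _ y)], with [y] in [V] below [x] and
    [rho y] the first [m] such that [R m y (delta x)].  A set [C] trivialising
    [g V] would bound [rho y] by one constant for uncountably many [y], whereas
    only finitely many [y] have [rho y] below a given bound.

    Otherwise there is an uncountable [Y] with finitely many members below each
    [x].  Then add to [A x], for each [z] in [Y] below [x], a set [L z] which is
    almost disjoint from all the [A x] and from the other [L z'], but meets
    [A y] above any given level for all but finitely many [y < z] in [Y].  Now
    [g V x] is the union of the [L z] with [z] in [V] below [x], and a Luzin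
    argument shows that it is not trivial.

    In both cases [g V] and [g V'] are inequivalent as soon as [V] minus [V']
    is uncountable, and an Ulam matrix provides [2 ^ omega_1] such sets. *)

Set Implicit Arguments.
Unset Strict Implicit.
Unset Printing Implicit Defensive.
Local Open Scope classical_set_scope.
Local Open Scope card_scope.
(* [eqE] is also a lemma of eqtype. *)
Local Notation eqE := Defs.eqE.

(** * Countability *)

Lemma uncountable_sub T (A B : set T) :
  A `<=` B -> ~ countable A -> ~ countable B.
Proof. by move=> AB nA /(sub_countable (subset_card_le AB)). Qed.

Lemma countable_setU T (A B : set T) :
  countable A -> countable B -> countable (A `|` B).
Proof.
move=> cA cB; rewrite -bigcup2E.
by apply: bigcup_countable => [|[|[|n]] _] //=; exact: countable0.
Qed.

Lemma countable_image T U (f : T -> U) (A : set T) :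
  countable A -> countable (f @` A).
Proof. by apply: sub_countable; exact: card_image_le. Qed.

Lemma uncountable_setD T (A B : set T) :
  ~ countable A -> countable B -> ~ countable (A `\` B).
Proof.
move=> nA cB cAB; apply: nA; apply: sub_countable (countable_setU cAB cB).
by apply: subset_card_le => x Ax; case: (pselect (B x)); [right|left].
Qed.

Lemma uncountable_ex T (A : set T) : ~ countable A -> exists x, A x.
Proof.
move=> nA; apply: contrapT => h; apply: nA.
suff -> : A = set0 by exact: countable0.
by apply/seteqP; split => // x Ax; apply: h; exists x.
Qed.

Lemma uncountable_infinite T (A : set T) : ~ countable A -> infinite_set A.
Proof. by move=> nA /finite_set_countable. Qed.

Lemma uncountable_pigeonhole T (A : set T) (Q : T -> nat -> Prop) :
  ~ countable A -> (forall x, A x -> exists n, Q x n) ->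
  exists n, ~ countable [set x | A x /\ Q x n].
Proof.
move=> nA hQ; apply: contrapT => h; apply: nA.
apply: (@sub_countable _ _ _ (\bigcup_n [set x | A x /\ Q x n])).
  by apply: subset_card_le => x Ax; have [n Qn] := hQ x Ax; exists n.
apply: bigcup_countable => // n _; apply: contrapT => hn; apply: h.
by exists n.
Qed.

Lemma infinite_natP T (A : set T) : infinite_set A ->
  exists s : nat -> T, injective s /\ forall n, A (s n).
Proof.
move=> /infiniteP/card_leP[f].
pose i (n : nat) : [set: nat] := SigSub (mem_set (I : [set: nat] n)).
exists (fun n => val (f (i n))); split=> [m n /val_inj e|n].
  by have /(congr1 val) := injT e.
by apply: set_mem; exact: valP.
Qed.

Lemma finite_bounded T (A : set T) (f : T -> nat) :
  finite_set A -> exists n, forall x, A x -> f x < n.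
Proof.
move=> /(finite_image f)/finite_seqP[s hs].
exists (\max_(i <- s) i).+1 => x Ax; rewrite ltnS.
have: f x \in s by have : (f @` A) (f x) by [exists x]; rewrite hs.
by move=> fs; exact: (@leq_bigmax_seq _ s xpredT id).
Qed.

Lemma infinite_ex_notin T (A B : set T) :
  infinite_set A -> finite_set B -> exists x, A x /\ ~ B x.
Proof.
move=> iA fB; apply: contrapT => h; apply: iA; apply: sub_finite_set fB.
by move=> x Ax; apply: contrapT => nB; apply: h; exists x.
Qed.

Lemma inj_surj_bijective T U (f : T -> U) :
  injective f -> (forall y, exists x, f x = y) -> bijective f.
Proof.
move=> fi fs; have [g gK] := choice fs.
by exists g => // x; apply: fi; rewrite gK.
Qed.

Lemma card_le_injective T U (f : T -> U) :
  injective f -> [set: T] #<= [set: U].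
Proof.
move=> fi; apply: (@card_le_trans _ _ _ (f @` [set: T])).
  by have /card_eqPle[] := @inj_card_eq _ _ [set: T] f (in2W fi).
exact: subset_card_le.
Qed.

Lemma Cantor_Bernstein_bij T U (f : T -> U) (g : U -> T) :
  injective f -> injective g -> exists h : T -> U, bijective h.
Proof.
move=> /card_le_injective TU /card_le_injective UT.
have /card_bijP[h [k hK kK]] := Cantor_Bernstein TU UT.
pose iT (x : T) : [set: T] := SigSub (mem_set (I : [set: T] x)).
pose iU (x : U) : [set: U] := SigSub (mem_set (I : [set: U] x)).
have iTK (x : [set: T]) : iT (val x) = x by apply: val_inj.
have iUK (x : [set: U]) : iU (val x) = x by apply: val_inj.
by exists (val \o h \o iT), (val \o k \o iU) => x /=;
  rewrite ?iUK ?iTK ?hK ?kK.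
Qed.

(** Transfinite recursion in which the value at [w] is chosen subject to [P] once the earlier values
    are known. By the second hypothesis [P w E] depends only on [E] below [w], so a partly built [E]
    can be judged. *)
Lemma wf_choice (W A : Type) (lt : W -> W -> Prop)
    (P : W -> (W -> A) -> A -> Prop) (a0 : A) :
  well_founded lt ->
  (forall w E E' a, (forall v, lt v w -> E v = E' v) -> P w E a -> P w E' a) ->
  (forall w E, (forall v, lt v w -> P v E (E v)) -> exists a, P w E a) ->
  exists E, forall w, P w E (E w).
Proof.
move=> wf Pext step.
(* [a0] is a junk value outside the initial segment of [w]; [Pext] makes it harmless. *)
pose ext w (rec : forall v, lt v w -> A) v :=
  if pselect (lt v w) is left h then rec v h else a0.
pose body w (rec : forall v, lt v w -> A) : A :=
  if pselect (exists a, P w (ext w rec) a) is left h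
  then sval (cid h) else a0.
pose E := Fix wf (fun=> A) body.
have EE w : E w = body w (fun v _ => E v).
  rewrite /E Fix_eq // => v f g fg; congr body.
  by apply: functional_extensionality_dep => y; apply: funext => h; exact: fg.
exists E; apply: (well_founded_ind wf) => w IH.
have ag v : lt v w -> ext w (fun v _ => E v) v = E v.
  by rewrite /ext; case: pselect.
have [a Pa] := step w E IH.
rewrite EE /body; case: pselect => [h|[]]; last first.
  by exists a; apply: Pext Pa => v /ag.
by case: (cid h) => b /= Pb; apply: Pext Pb => v /ag.
Qed.

(** * Well-orders of type omega_1 *)

Section Omega1.
Variables (W : Type) (lt : W -> W -> Prop).
Hypothesis W1 : is_omega1 lt.

Definition leo a b := a = b \/ lt a b.

Lemma lto_irr a : ~ lt a a. Proof. by have [h _] := W1. Qed.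
Lemma lto_trans a b c : lt a b -> lt b c -> lt a c.
Proof. by have [_ [h _]] := W1; exact: h. Qed.
Lemma lto_wf : well_founded lt. Proof. by have [_ [_ [_ [h _]]]] := W1. Qed.
Lemma omega1_uncountable : ~ countable [set: W].
Proof. by have [_ [_ [_ [_ [h _]]]]] := W1. Qed.
Lemma lto_countable w : countable [set v | lt v w].
Proof. by have [_ [_ [_ [_ [_ h]]]]] := W1. Qed.

Lemma leo_trans a b c : leo a b -> leo b c -> leo a c.
Proof.
by move=> [->//|ab] [<-|bc]; right=> //; exact: lto_trans ab bc.
Qed.
Lemma leo_lt_trans a b c : leo a b -> lt b c -> lt a c.
Proof. by move=> [->//|]; exact: lto_trans. Qed.
Lemma leo_total a b : leo a b \/ lt b a.
Proof.
have [_ [_ [h _]]] := W1.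
by case: (h a b) => [|[|]] ?; [left; right|left; left|right].
Qed.

Lemma leo_max a b : exists d, leo a d /\ leo b d.
Proof.
case: (leo_total a b) => [ab|ba]; first by exists b; split=> //; left.
by exists a; split; [left|right].
Qed.

Lemma leo_countable w : countable [set v | leo v w].
Proof.
apply: sub_countable (countable_setU (countable1 w) (lto_countable w)).
by apply: subset_card_le => v [->|]; [left|right].
Qed.

Lemma countable_bounded (A : set W) :
  countable A -> exists d, forall a, A a -> leo a d.
Proof.
move=> cA.
have cB : countable (\bigcup_(a in A) [set v | leo v a]).
  by apply: bigcup_countable => // a _; exact: leo_countable.
have [d [_ hd]] := uncountable_ex (uncountable_setD omega1_uncountable cB).
exists d => a Aa; case: (leo_total a d) => // da.
by case: hd; exists a => //; right.
Qed.

Lemma uncountable_above (Z : set W) d :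
  ~ countable Z -> exists z, Z z /\ lt d z.
Proof.
move=> nZ; have [z [Zz hz]] := uncountable_ex (uncountable_setD nZ (leo_countable d)).
by exists z; split=> //; case: (leo_total z d).
Qed.

(** A countably infinite part of [Z] is bounded in [W], and the uncountable [Z] has a member beyond
    the bound. *)
Lemma uncountable_infinite_initial (Z : set W) :
  ~ countable Z -> exists z, Z z /\ infinite_set [set y | Z y /\ lt y z].
Proof.
move=> nZ; have [s [si sZ]] := infinite_natP (uncountable_infinite nZ).
have [d hd] := countable_bounded (countable_image s (countableP [set: nat])).
have [z [Zz dz]] := uncountable_above d nZ; exists z; split=> //.
apply: (@sub_infinite_set _ (range s)).
  by move=> _ [n _ <-]; split=> //; apply: leo_lt_trans dz; apply: hd; exists n.
by rewrite (eq_finite_set (inj_card_eq (in2W si))); exact: infinite_nat.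
Qed.

Lemma omega1_inj T (P : set T) : ~ countable P ->
  exists h : W -> T, injective h /\ forall w, P (h w).
Proof.
move=> nP; have [t0 _] := uncountable_ex nP.
pose Q w (h : W -> T) t := P t /\ forall v, lt v w -> h v <> t.
have [h hQ] : exists h, forall w, Q w h (h w).
  apply: (wf_choice t0 lto_wf) => [w E E' t ag [Pt ht]|w E _].
    by split=> // v vw; rewrite -ag //; exact: ht.
  have cI : countable (E @` [set v | lt v w]).
    exact: countable_image (lto_countable w).
  have [t [Pt ht]] := uncountable_ex (uncountable_setD nP cI).
  by exists t; split=> // v vw e; apply: ht; exists v.
exists h; split=> [v w e|w]; last by have [] := hQ w.
case: (leo_total v w) => [[//|vw]|wv].
  by have [_ /(_ _ vw)] := hQ w.
by have [_ /(_ _ wv)] := hQ v; rewrite e.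
Qed.

End Omega1.

(* The rows of an Ulam matrix. *)
Lemma uncountable_partition W (lt : W -> W -> Prop) W' (lt' : W' -> W' -> Prop)
    (P : set W) :
  is_omega1 lt -> is_omega1 lt' -> ~ countable P ->
  exists D : W' -> set W, [/\ forall w, D w `<=` P,
    forall w, ~ countable (D w) & forall u v x, D u x -> D v x -> u = v].
Proof.
move=> W1 W1' nP.
have /choice[e ei] : forall b, exists f : W -> nat,
    {in [set a | lt a b] &, injective f}.
  by move=> b; apply/countable_injP; exact: (lto_countable W1).
(* [e b] numbers the elements below [b]. For each [a], uncountably many [b] above it give [a] one
   and the same number, and uncountably many [a] then share such a number [n]. Two rows meeting in
   [x] coincide because [e x] is injective. *)
have hn a : exists n, ~ countable [set b | (P `\` [set v | leo lt v a]) b /\ e b a = n].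
  apply: uncountable_pigeonhole => [|b _]; last by exists (e b a).
  exact: uncountable_setD nP (leo_countable W1 a).
have [n nn] := uncountable_pigeonhole (omega1_uncountable W1) (fun a _ => hn a).
have [h [hi hu]] := omega1_inj W1' nn.
exists (fun w => [set b | (P `\` [set v | leo lt v (h w)]) b /\ e b (h w) = n]).
split=> [w b [[]]//|w|u v x [[_ hx] eu] [[_ hx'] ev]]; first by have [] := hu w.
apply: hi; apply: (ei x); rewrite ?eu ?ev //; apply: mem_set => /=.
  by case: (leo_total W1 x (h u)).
by case: (leo_total W1 x (h v)).
Qed.

(** Each of omega_1 many disjoint uncountable sets contains an injective sequence. *)
Lemma omega1_prod_nat W (lt : W -> W -> Prop) : is_omega1 lt ->
  exists q : W * nat -> W, injective q.
Proof.
move=> W1.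
have [D [_ nD dD]] :=
  uncountable_partition W1 W1 (omega1_uncountable W1).
have /choice[s hs] : forall w, exists s : nat -> W,
    injective s /\ forall n, D w (s n).
  by move=> w; apply: infinite_natP; apply: uncountable_infinite.
exists (fun p => s p.1 p.2) => -[u m] [v n] /= e.
have uv : u = v.
  by apply: (dD _ _ (s u m)); [case: (hs u) => _ | rewrite e; case: (hs v) => _].
by rewrite uv in e *; have [/(_ _ _ e) ->] := hs v.
Qed.

(** * Forest orders *)

Section Forests.
Variables (W : Type) (lt : W -> W -> Prop).
Hypothesis W1 : is_omega1 lt.
Local Notation leo := (leo lt).

(** The sequence climbs past the elements below [w] in the order of an enumeration. It is only
    weakly increasing, as [w] may be a successor. *)
Lemma cofinal_sequence w : (exists v, lt v w) ->
  exists s : nat -> W, [/\ forall k, lt (s k) w, forall k, leo (s k) (s k.+1)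
    & forall v, lt v w -> exists k, leo v (s k)].
Proof.
move=> [v0 v0w].
have /countable_injP[f fi] := lto_countable W1 w.
pose nxt k u v := [/\ lt v w, leo u v
  & forall x, lt x w -> f x = k -> leo x v].
have hnxt k u : exists v, lt u w -> nxt k u v.
  have [uw|nuw] := pselect (lt u w); last by exists u.
  have [[x [xw fx]]|nx] := pselect (exists x, lt x w /\ f x = k); last first.
    by exists u => _; split=> // [|x xw fx]; [left|case: nx; exists x].
  have uniq y : lt y w -> f y = k -> y = x.
    by move=> yw fy; apply: fi; rewrite ?fy ?fx //; exact: mem_set.
  case: (leo_total W1 u x) => [ux|xu].
    by exists x => _; split=> // y yw /(uniq _ yw) ->; left.
  exists u => _; split=> // [|y yw /(uniq _ yw) ->]; first by left.
  by right.
have /choice[g gP] : forall ku : nat * W, exists v, lt ku.2 w -> nxt ku.1 ku.2 v.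
  by move=> [k u]; exact: hnxt.
pose s := fix s k := if k is k'.+1 then g (k', s k') else v0.
have sw k : lt (s k) w by elim: k => //= k /(gP (k, _))[].
exists s; split=> // [k|v vw]; first by have [] := gP (k, s k) (sw k).
by exists (f v).+1; have [_ _] := gP (f v, s (f v)) (sw (f v)); exact.
Qed.

(** Conditions on the row of [g]: [F n] stands for the set of [a] with [R n a g], and [E b] for the
    row of an earlier [b]. The last two clauses are those of [forests] with top [g]; they consult
    [E] below [g] only, as [wf_choice] demands. *)
Definition stage (g : W) (E : W -> nat -> set W) (F : nat -> set W) :=
  [/\ (forall n a, F n a -> leo a g) /\ (forall n, F n g),
      (forall n, F n `<=` F n.+1) /\ (forall a, leo a g -> exists n, F n a),
      forall n, finite_set (F n),
      forall n a b, lt b g -> F n b -> E b n a -> F n a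
    & forall n a b, lt b g -> F n a -> F n b -> leo a b -> E b n a].

(** The new row adds [g] to the rows of points [be n] that climb to [g] along a cofinal sequence,
    slowly enough for these rows to increase with [n]. *)
Lemma stage_step g E :
  (forall b, lt b g -> stage b E (E b)) -> exists F, stage g E F.
Proof.
move=> IH.
have [hg|ng] := pselect (exists v, lt v g); last first.
  exists (fun=> [set g]); split.
  - by split=> [n a ->|n]; [left|].
  - split=> [n|a]; first exact.
    move=> [->|ag]; first by exists 0.
    by case: ng; exists a.
  - by move=> n; exact: finite_set1.
  - by move=> n a b bg e; case: ng; exists b.
  - by move=> n a b bg; case: ng; exists b.
have [s [sg smono scof]] := cofinal_sequence hg.
have Emono b m n : lt b g -> m <= n -> E b m `<=` E b n.
  move=> bg /subnKC <-; elim: (n - m) => [|k IHk]; first by rewrite addn0.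
  rewrite addnS; apply: subset_trans IHk _.
  by have [_ [h _] _ _ _] := IH b bg; exact: h.
have Etop b n : lt b g -> E b n b by move=> /IH[[]].
have Etrans n a b c : lt c g -> E c n b -> E b n a -> E c n a.
  move=> cg cb ba; have [[h _] _ _ t _] := IH c cg.
  by case: (h _ _ cb) => [e|bc]; [rewrite -e|exact: t cb ba].
(* The index moves on at level [n] only if the current term already belongs to the row of the next
   term at that level; transitivity then yields [beS]. *)
pose k := fix k n := if n is n'.+1 then
  if `[< E (s (k n').+1) n (s (k n')) >] then (k n').+1 else k n' else 0.
pose be n := s (k n).
have beg n : lt (be n) g by exact: sg.
have be1 n : E (be n.+1) n.+1 (be n).
  rewrite /be /=; case: asboolP => // _; exact: Etop.
have beS n : E (be n) n `<=` E (be n.+1) n.+1.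
  move=> a /(Emono _ _ _ (beg n) (leqnSn n)) h.
  exact: Etrans (beg _) (be1 n) h.
have beD n d : E (be n) n `<=` E (be (n + d)) (n + d).
  elim: d => [|d IHd]; first by rewrite addn0.
  by rewrite addnS; exact: subset_trans IHd (@beS _).
have kS n : k n <= k n.+1 by rewrite /=; case: ifP.
have kD n d : k n <= k (n + d).
  by elim: d => [|d IHd]; rewrite ?addn0 ?addnS //; exact: leq_trans IHd (kS _).
(* The index cannot stay at [K]: [s K] enters the row of [s K.+1] at some level [N], and from then
   on the test succeeds. *)
have kunb K : exists n, K <= k n.
  elim: K => [|K [n Kn]]; first by exists 0.
  have [N hN] : exists N, E (s K.+1) N (s K).
    by have [_ [_ h] _ _ _] := IH _ (sg K.+1); apply: h.
  have := leq_trans Kn (kD n N); rewrite leq_eqVlt => /orP[/eqP e|h]; last first.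
    by exists (n + N).
  exists (n + N).+1; rewrite /= -e; case: asboolP => // -[].
  by apply: Emono hN => //; rewrite ltnW // ltnS leq_addl.
have smonoD K d : leo (s K) (s (K + d)).
  elim: d => [|d IHd]; first by rewrite addn0; left.
  by rewrite addnS; exact: (leo_trans W1) IHd (smono _).
exists (fun n => E (be n) n `|` [set g]); split.
- split=> [n a [h|->]|n]; [|by left|by right].
  have [[hl _] _ _ _ _] := IH _ (beg n).
  by right; apply: (leo_lt_trans W1) (beg n); exact: hl h.
- split=> [n|a [->|ag]]; first by move=> a [/beS|->]; [left|right].
    by exists 0; right.
  have [K aK] := scof a ag; have [n Kn] := kunb K.
  have abe : leo a (be n).
    by apply: (leo_trans W1) aK _; rewrite /be -(subnKC Kn); exact: smonoD.
  have [N hN] : exists N, E (be n) N a.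
    by have [_ [_ h] _ _ _] := IH _ (beg n); exact: h.
  exists (n + N); left; apply: (Etrans _ _ (be n)) => //.
    by apply: beD; exact: Etop.
  by apply: Emono hN => //; exact: leq_addl.
- move=> n; rewrite finite_setU; split; last exact: finite_set1.
  by have [_ _ h _ _] := IH _ (beg n); exact: h.
- move=> n a b bg [h|e]; last by move: bg; rewrite e => /(lto_irr W1).
  by move=> ba; left; exact: Etrans h ba.
- move=> n a b bg [ha|e] [hb|e'] ab.
  + have [[hl _] _ _ _ t] := IH _ (beg n).
    by case: (hl _ _ hb) => [->//|bb]; exact: t ab.
  + by move: bg; rewrite e' => /(lto_irr W1).
  + by have := leo_lt_trans W1 ab bg; rewrite e => /(lto_irr W1).
  + by move: bg; rewrite e' => /(lto_irr W1).
Qed.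

(* [R n a b] is [leo a b /\ rho a b <= n] for a finite-to-one [rho] on pairs
   of countable ordinals which satisfies two of the three ultrametric
   inequalities. *)
Definition forests (R : nat -> W -> W -> Prop) :=
  [/\ (forall n a b, R n a b -> leo a b) /\ (forall n a, R n a a),
      (forall m n a b, m <= n -> R m a b -> R n a b) /\
        (forall a b, leo a b -> exists n, R n a b),
      forall n b, finite_set [set a | R n a b],
      forall n a b c, R n a b -> R n b c -> R n a c
    & forall n a b c, R n a c -> R n b c -> leo a b -> R n a b].

Lemma forests_exist : exists R, forests R.
Proof.
have [E hE] : exists E, forall g, stage g E (E g).
  apply: (wf_choice (fun=> set0) (lto_wf W1)) => [w E E' F ag|]; last first.
    exact: stage_step.
  by move=> [? ? ? h1 h2]; split=> // n a b bw; rewrite -ag //; [exact: h1|exact: h2].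
exists (fun n a b => E b n a); split.
- by split=> [n a b|n a]; [have [[h _] _ _ _ _] := hE b; exact: h
    |have [[_ h] _ _ _ _] := hE a; exact: h].
- split=> [m n a b /subnKC <-|a b]; last by have [_ [_ h] _ _ _] := hE b; exact: h.
  elim: (n - m) => [|k IHk] h; first by rewrite addn0.
  by rewrite addnS; have [_ [hS _] _ _ _] := hE b; apply: hS; exact: IHk.
- by move=> n b; have [_ _ h _ _] := hE b; exact: h.
- move=> n a b c ab bc; have [[h _] _ _ t _] := hE c.
  by case: (h _ _ bc) => [<-//|bc']; exact: t bc ab.
- move=> n a b c ac bc ab; have [[h _] _ _ _ t] := hE c.
  by case: (h _ _ bc) => [->//|bc']; exact: t bc ab.
Qed.

(** Choosing [c n b] above the finitely many [c n a] with [R n a b] makes [c n] strictly increasing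
    along the chain of [R n]-predecessors of [d]. *)
Lemma forests_height R : forests R -> exists c : nat -> W -> nat,
  forall n a b d, R n a d -> R n b d -> c n a = c n b -> a = b.
Proof.
move=> [[_ _] _ Rfin _ Rsub].
pose P w (c : W -> nat -> nat) t := forall n b, lt b w -> R n b w -> c b n < t n.
have [c hc] : exists c, forall w, P w c (c w).
  apply: (wf_choice (fun=> 0) (lto_wf W1)) => [w E E' t ag h n b bw|w E _].
    by rewrite -ag //; exact: h.
  have /choice[t ht] : forall n, exists t, forall b, R n b w -> E b n < t.
    by move=> n; exact: finite_bounded (Rfin n w).
  by exists t => n b _; exact: ht.
exists (fun n a => c a n) => n a b d ad bd e.
case: (leo_total W1 a b) => [[//|ab]|ba].
  by have := hc b n a ab (Rsub _ _ _ _ ad bd (or_intror ab)); rewrite e ltnn.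
by have := hc a n b ba (Rsub _ _ _ _ bd ad (or_intror ba)); rewrite e ltnn.
Qed.

End Forests.

(** * The almost-meet-preserving families *)

Definition pt (m k : nat) : nat := pickle (m, k).

Lemma pt_inj m k m' k' : pt m k = pt m' k' -> m = m' /\ k = k'.
Proof. by move=> /(pcan_inj pickleK)[]. Qed.

(** For such a set, being almost contained in another means being contained in it from some level
    on, by [layered_subE] and [subE_layer]. *)
Definition layered (A : set nat) :=
  (forall q, A q -> exists m k, q = pt m k) /\
  forall m, finite_set [set k | A (pt m k)].

Lemma layered_sub A B : A `<=` B -> layered B -> layered A.
Proof.
move=> AB [Bpt Bfin]; split=> [q /AB/Bpt//|m].
by apply: sub_finite_set (Bfin m) => k /AB.
Qed.

Lemma layered_subE A B : layered A ->
  (exists N, forall m k, N <= m -> A (pt m k) -> B (pt m k)) -> subE A B.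
Proof.
move=> [Apt Afin] [N AB].
apply: (@sub_finite_set _ _ (\bigcup_(m in `I_N) (pt m @` [set k | A (pt m k)]))).
  move=> q [Aq nBq]; have [m [k e]] := Apt q Aq; subst q.
  exists m; last by exists k.
  by rewrite /= ltnNge; apply/negP => Nm; apply: nBq; exact: AB.
apply: bigcup_finite => [|m _]; first exact: finite_II.
exact: finite_image.
Qed.

Lemma layered_finite A : layered A ->
  (exists N, forall m k, A (pt m k) -> m < N) -> finite_set A.
Proof.
move=> lA [N hN]; rewrite -[A]setD0; apply: layered_subE lA _.
by exists N => m k Nm /hN; rewrite ltnNge Nm.
Qed.

Lemma subE_layer A B : subE A B ->
  exists N, forall m k, N <= m -> A (pt m k) -> B (pt m k).
Proof.
(* [lev] reads off the level of a point; 0 is a dummy for numbers that code no pair. *)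
pose lev q := if @unpickle (nat * nat)%type q is Some p then p.1 else 0.
move=> /(finite_bounded lev)[N hN]; exists N => m k Nm Ap.
apply: contrapT => nB; have := hN _ (conj Ap nB).
by rewrite /lev /pt pickleK /= ltnNge Nm.
Qed.

(** * The base family, built on the levels of the forests *)

Section Semilattice.
Variables (W : Type) (lt : W -> W -> Prop) (le : W -> W -> Prop).
Variables (R : nat -> W -> W -> Prop) (c : nat -> W -> nat) (delta : W -> W).
Hypothesis W1 : is_omega1 lt.
Hypothesis leP : partial_order le.
Hypothesis Rforests : forests lt R.
Hypothesis c_inj :
  forall n a b d, R n a d -> R n b d -> c n a = c n b -> a = b.
Hypothesis deltaP : forall x y, le y x -> leo lt y (delta x).

Let le_refl x : le x x. Proof. by have [h _] := leP. Qed.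
Let le_trans x y z : le x y -> le y z -> le x z.
Proof. by have [_ [_ h]] := leP; exact: h. Qed.
Let Rmono m n a b : m <= n -> R m a b -> R n a b.
Proof. by have [_ [h _] _ _ _] := Rforests; exact: h. Qed.
Let Rtrans n a b d : R n a b -> R n b d -> R n a d.
Proof. by have [_ _ _ h _] := Rforests; exact: h. Qed.
Let Rsub n a b d : R n a d -> R n b d -> leo lt a b -> R n a b.
Proof. by have [_ _ _ _ h] := Rforests; exact: h. Qed.
Let Rfin n b : finite_set [set a | R n a b].
Proof. by have [_ _ h _ _] := Rforests; exact: h. Qed.
Let Rex a b : leo lt a b -> exists n, R n a b.
Proof. by have [_ [_ h] _ _ _] := Rforests; exact: h. Qed.

(** This lets several bounds [delta x] be replaced by one common [D], at the price of finitely many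
    levels. *)
Let stable D N d :=
  forall m y, N <= m -> leo lt y d -> R m y d <-> R m y D.

Lemma stable_exists D d : leo lt d D -> exists N, stable D N d.
Proof.
move=> /Rex[N dD]; exists N => m y Nm yd.
have dD' := Rmono Nm dD; split=> [yd'|yD]; first exact: Rtrans yd' dD'.
exact: Rsub yD dD' yd.
Qed.

Lemma stable_leq D N N' d : N <= N' -> stable D N d -> stable D N' d.
Proof. by move=> NN' h m y /(leq_trans NN'); exact: h. Qed.

Lemma stable3 d1 d2 d3 :
  exists D N, [/\ stable D N d1, stable D N d2 & stable D N d3].
Proof.
have [D' [h1 h2]] := leo_max W1 d1 d2; have [D [h' h3]] := leo_max W1 D' d3.
have [N1 s1] := stable_exists (leo_trans W1 h1 h').
have [N2 s2] := stable_exists (leo_trans W1 h2 h').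
have [N3 s3] := stable_exists h3.
by exists D, (maxn N1 (maxn N2 N3)); split;
  [apply: stable_leq s1|apply: stable_leq s2|apply: stable_leq s3];
  rewrite !leq_max leqnn ?orbT.
Qed.

Definition base_set (x : W) : set nat :=
  [set q | exists m y, [/\ q = pt m (c m y), R m y (delta x) & le y x]].

Lemma base_set_pt x m k :
  base_set x (pt m k) <-> exists y, [/\ k = c m y, R m y (delta x) & le y x].
Proof.
split=> [[m' [y [/pt_inj[e ek] Ry yx]]]|[y [-> Ry yx]]]; last by exists m, y.
by subst; exists y.
Qed.

Lemma base_set_stable D N x m k : stable D N (delta x) -> N <= m ->
  base_set x (pt m k) <-> exists y, [/\ k = c m y, R m y D & le y x].
Proof.
move=> st Nm; rewrite base_set_pt; split=> -[y [-> Ry yx]];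
  by exists y; split=> //; apply/(st _ _ Nm (deltaP yx)).
Qed.

Lemma layered_base_set x : layered (base_set x).
Proof.
split=> [q [m [y [-> _ _]]]|m]; first by exists m, (c m y).
apply: sub_finite_set (finite_image (c m) (Rfin m (delta x))).
by move=> k /base_set_pt[y [-> Ry _]]; exists y.
Qed.

Lemma base_set_meet x y z : (forall w, le w z <-> le w x /\ le w y) ->
  eqE (base_set x `&` base_set y) (base_set z).
Proof.
move=> hz; have [D [N [sx sy sz]]] := stable3 (delta x) (delta y) (delta z).
split; apply: layered_subE.
- by apply: layered_sub (layered_base_set x) => q [].
- exists N => m k Nm [].
  move=> /(base_set_stable _ sx Nm)[u [ek Ru ux]].
  move=> /(base_set_stable _ sy Nm)[v [ek' Rv vy]].
  have uv : u = v by apply: c_inj Ru Rv _; rewrite -ek.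
  by apply/(base_set_stable _ sz Nm); exists u; split=> //; apply/hz; rewrite {2}uv.
- exact: layered_base_set.
- exists N => m k Nm /(base_set_stable _ sz Nm)[u [ek Ru /hz[ux uy]]].
  by split; [apply/(base_set_stable _ sx Nm)|apply/(base_set_stable _ sy Nm)]; exists u.
Qed.

(** For the converse, take the point that [x] itself contributes to a high level: decoded in
    [base_set y] along the chain below [D], it gives back [x], so [x] is below [y]. *)
Lemma base_set_le x y : le x y <-> subE (base_set x) (base_set y).
Proof.
split=> [xy|].
  have hx w : le w x <-> le w x /\ le w y.
    by split=> [wx|[]//]; split=> //; exact: le_trans xy.
  have [_] := base_set_meet hx; apply: sub_finite_set => q [Aq nAq].
  by split=> // -[].
move=> /subE_layer[N1 h1].
have [D [N [sx sy _]]] := stable3 (delta x) (delta y) (delta y).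
have [N2 h2] := Rex (deltaP (le_refl x)).
pose m := maxn N1 (maxn N N2).
have Nm : N <= m by rewrite !leq_max leqnn orbT.
have xD : R m x D.
  apply/(sx _ _ Nm (deltaP (le_refl x))); apply: Rmono h2.
  by rewrite !leq_max leqnn !orbT.
have : base_set y (pt m (c m x)).
  apply: h1; first by rewrite leq_max leqnn.
  by apply/(base_set_stable _ sx Nm); exists x.
move=> /(base_set_stable _ sy Nm)[u [e Ru uy]].
by rewrite (c_inj xD Ru e).
Qed.

(** * First case: systems recording the level at which a node enters *)

Section Rho.
Variables (U : set W).
Hypothesis Uinf : forall Z : set W, Z `<=` U -> ~ countable Z ->
  exists x, infinite_set [set y | Z y /\ le y x].

(** [m.+1] is the level at which [y] enters the chain below [delta x]. The finitely many [y] present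
    at level 0 contribute no point. *)
Definition rho_sys (V : set W) (x : W) : set nat :=
  [set q | exists m y, [/\ q = pt m.+1 (c m.+1 y), R m.+1 y (delta x),
    ~ R m y (delta x), le y x & V y]].

Lemma rho_sys_sub V x : rho_sys V x `<=` base_set x.
Proof. by move=> q [m [y [-> Ry _ yx _]]]; exists m.+1, y. Qed.

Lemma rho_sys_pt V x m y : R m y (delta x) ->
  rho_sys V x (pt m (c m y)) -> V y /\ forall n, n < m -> ~ R n y (delta x).
Proof.
move=> Ry [m' [y' [/pt_inj[e1 e2] Ry' nRy' _ Vy]]]; subst m.
have e := c_inj Ry Ry' e2; subst y'.
by split=> // n; rewrite ltnS => nm /(Rmono nm).
Qed.

(** Beyond the stable levels, entering below [delta x] and entering below [delta y] both amount to
    entering below [D]. *)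
Lemma rho_sys_coherent V x y : le y x ->
  eqE (rho_sys V x `&` base_set y) (rho_sys V y).
Proof.
move=> yx; have [D [N [sx sy _]]] := stable3 (delta x) (delta y) (delta y).
split; apply: layered_subE.
- by apply: layered_sub (layered_base_set y) => q [].
(* Entering at [m'.+1] also involves the level [m'], which has to be stable too. *)
- exists N.+1 => m k Nm [[m' [u [/pt_inj[e1 ek] Ru nRu ux Vu]]]].
  subst m k; have Nm' := ltnW Nm.
  move=> /(base_set_stable _ sy Nm')[v [e Rv vy]].
  have /(sx _ _ Nm' (deltaP ux)) Ru' := Ru.
  have uv := c_inj Ru' Rv e; subst v.
  exists m', u; split=> //; first exact/(sy _ _ Nm' (deltaP vy)).
  by move=> /(sy _ _ Nm (deltaP vy))/(sx _ _ Nm (deltaP ux)).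
- by apply: layered_sub (layered_base_set y); exact: rho_sys_sub.
- exists N.+1 => m k Nm h; split; last exact: rho_sys_sub h.
  case: h => m' [u [/pt_inj[e1 ek] Ru nRu uy Vu]]; subst m k.
  have Nm' := ltnW Nm; have ux := le_trans uy yx.
  exists m', u; split=> //.
    by apply/(sx _ _ Nm' (deltaP ux))/(sy _ _ Nm' (deltaP uy)).
  by move=> /(sx _ _ Nm (deltaP ux))/(sy _ _ Nm (deltaP uy)).
Qed.

Lemma rho_sys_nontrivial V V' C : V `\` V' `<=` U -> ~ countable (V `\` V') ->
  ~ forall x, eqE (C `&` base_set x) (symdiff (rho_sys V x) (rho_sys V' x)).
Proof.
move=> VU nV hC.
(* Testing [C] at [y] itself, where [y] enters at one fixed level, shows that [C] omits the points
   of [y] from some level on. *)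
pose Q y n := forall m, n <= m -> ~ C (pt m (c m y)).
have [y _|n nZ] := uncountable_pigeonhole (Q := Q) nV.
  have [/subE_layer[N1 h1] _] := hC y.
  have [N2 h2] := Rex (deltaP (le_refl y)).
  exists (maxn N1 N2).+1 => m; rewrite gtn_max => /andP[N1m N2m] Cp.
  have Ry := Rmono (ltnW N2m) h2.
  have : symdiff (rho_sys V y) (rho_sys V' y) (pt m (c m y)).
    by apply: h1 (ltnW N1m) _; split=> //; exists m, y.
  by move=> [[]|[]] /(rho_sys_pt Ry)[_ /(_ _ N2m)].
have [x hx] : exists x,
    infinite_set [set y | [set y | (V `\` V') y /\ Q y n] y /\ le y x].
  by apply: Uinf nZ => y [/VU].
have [_ /subE_layer[N hN]] := hC x.
(* At [x], all but finitely many of these [y] enter above level [n + N], where [C] must contain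
   their points of entry. *)
have [y [[[[Vy nV'y] Qy] yx] nRy]] := infinite_ex_notin hx (Rfin (n + N) (delta x)).
have ex : exists m, `[< R m y (delta x) >].
  by have [m Rm] := Rex (deltaP yx); exists m; apply/asboolP.
case: (ex_minnP ex) => m /asboolP Rm mmin.
have mN : n + N < m.
  by rewrite ltnNge; apply/negP => /Rmono/(_ Rm).
apply: (Qy m (ltnW (leq_ltn_trans (leq_addr N n) mN))).
have [] // : (C `&` base_set x) (pt m (c m y)).
apply: hN; first exact: ltnW (leq_ltn_trans (leq_addl n N) mN).
left; split; last by move=> /(rho_sys_pt Rm)[].
case: m Rm mmin mN => // m Rm mmin _; exists m, y; split=> //.
by move=> /asboolP/mmin; rewrite ltnn.
Qed.

End Rho.

(** * Second case: adjoining a Luzin-type family *)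

Section Luzin.
Variables (Y : set W) (phi : W -> W -> nat).
Hypothesis Yfin : forall x, finite_set [set y | Y y /\ le y x].
Hypothesis phiR : forall y z, lt y z -> R (phi y z) y z.
Hypothesis phiM : forall y z, lt y z -> exists j, phi y z = pt j (c j z).

(** This is the set [L z] of the overview. By [phiM] its levels carry a code of [z], which keeps
    different pieces almost disjoint; by [phiR] each level is finite. *)
Definition piece (z : W) : set nat :=
  [set q | exists y, [/\ q = pt (phi y z) (c (phi y z) y), Y y & lt y z]].

Lemma piece_pt z m k : piece z (pt m k) ->
  exists y, [/\ m = phi y z, k = c m y, Y y & lt y z].
Proof. by move=> [y [/pt_inj[-> ->] Yy yz]]; exists y. Qed.

Lemma layered_piece z : layered (piece z).
Proof.
split=> [q [y [-> _ _]]|m]; first by exists (phi y z), (c (phi y z) y).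
apply: sub_finite_set (finite_image (c m) (Rfin m z)).
by move=> k /piece_pt[y [e -> _ yz]]; exists y => //=; rewrite e; exact: phiR.
Qed.

(** At a stable level a common point comes from a single [y], which is in [Y] and below [x]. There
    are finitely many such [y], hence finitely many levels [phi y z]. *)
Lemma finite_piece_base_set z x : finite_set (piece z `&` base_set x).
Proof.
apply: layered_finite; first by apply: layered_sub (layered_piece z) => q [].
have [D [N [sx sz _]]] := stable3 (delta x) z z.
have [B hB] := finite_bounded (phi ^~ z) (Yfin x).
exists (maxn N B) => m k [/piece_pt[y [em ek Yy yz]] Ak]; rewrite leq_max.
case: (ltnP m N) => //= Nm.
have /(base_set_stable _ sx Nm)[v [ev Rv vx]] := Ak.
have Ry : R m y D.
  by apply/(sz _ _ Nm (or_intror yz)); rewrite em; exact: phiR.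
have yv : y = v by apply: c_inj Ry Rv _; rewrite -ek.
by rewrite em; apply: hB; split=> //; rewrite yv.
Qed.

(** A common level codes both [(j, c j z)] and [(j, c j z')]. For [j] at least [N], [z] and [z'] lie
    on one chain of [R j], so they would be equal; only the levels with [j < N] remain. *)
Lemma finite_pieceI z z' : z <> z' -> finite_set (piece z `&` piece z').
Proof.
move=> zz'.
apply: layered_finite; first by apply: layered_sub (layered_piece z) => q [].
have [D [N [sz sz' _]]] := stable3 z z' z.
have [B hB] := finite_bounded (fun j => pt j (c j z)) (finite_II N).
have Rrefl n a : R n a a by have [[_ h] _ _ _ _] := Rforests.
exists B => m k [/piece_pt[y [em _ _ yz]] /piece_pt[y' [em' _ _ yz']]].
have [j ej] := phiM yz; have [j' ej'] := phiM yz'.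
have /pt_inj[ej1 ej2] : pt j (c j z) = pt j' (c j' z') by rewrite -ej -ej' -em.
subst j'; rewrite em ej; apply: hB => /=; rewrite ltnNge; apply/negP => Nj.
apply: zz'; apply: (c_inj (d := D) _ _ ej2).
  by apply/(sz _ _ Nj); first by left.
by apply/(sz' _ _ Nj); first by left.
Qed.

Definition luzin_sys (V : set W) (x : W) : set nat :=
  [set q | exists z, [/\ Y z, V z, le z x & piece z q]].

Definition luzin_set (x : W) : set nat := base_set x `|` luzin_sys setT x.

Let clash x y : set nat := [set q | exists z z',
  [/\ Y z /\ le z x, Y z' /\ le z' y, z <> z', piece z q & piece z' q]].

Lemma finite_luzin_sys_base_set V x y : finite_set (luzin_sys V x `&` base_set y).
Proof.
apply: (@sub_finite_set _ _
  (\bigcup_(z in [set z | Y z /\ le z x]) (piece z `&` base_set y))).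
  by move=> q [[z [Yz _ zx Lz] Aq]]; exists z.
by apply: bigcup_finite => // z _; exact: finite_piece_base_set.
Qed.

Lemma finite_clash x y : finite_set (clash x y).
Proof.
apply: (@sub_finite_set _ _ (\bigcup_(z in [set z | Y z /\ le z x])
  \bigcup_(z' in [set z' | Y z' /\ le z' y]) [set q | z <> z' /\ (piece z `&` piece z') q])).
  by move=> q [z [z' [hz hz' zz' Lz Lz']]]; exists z => //; exists z'.
apply: bigcup_finite => // z _; apply: bigcup_finite => // z' _.
have [e|zz'] := pselect (z = z').
  by apply: sub_finite_set (finite_set0 _) => q [].
by apply: sub_finite_set (finite_pieceI zz') => q [].
Qed.

Lemma luzin_sys_le V x y : le x y -> luzin_sys V x `<=` luzin_sys V y.
Proof.
by move=> xy q [z [Yz Vz zx Lz]]; exists z; split=> //; exact: le_trans xy.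
Qed.

Lemma luzin_sys_sub V x : luzin_sys V x `<=` luzin_set x.
Proof. by move=> q [z [Yz Vz zx Lz]]; right; exists z. Qed.

Lemma luzin_set_subE x y : le x y -> subE (luzin_set x) (luzin_set y).
Proof.
move=> xy; have /base_set_le := xy; apply: sub_finite_set => q [Aq nAq].
split; last by move=> h; apply: nAq; left.
by case: Aq => // /(luzin_sys_le xy) h; case: nAq; right.
Qed.

Lemma luzin_set_meet x y z : (forall w, le w z <-> le w x /\ le w y) ->
  eqE (luzin_set x `&` luzin_set y) (luzin_set z).
Proof.
move=> hz; split.
  have [h0 _] := base_set_meet hz.
  have := finite_luzin_sys_base_set setT x y; have := finite_luzin_sys_base_set setT y x.
  have := finite_clash x y; move: h0; rewrite /subE.
  move=> h0 h1 h2 h3.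
  have : finite_set (((base_set x `&` base_set y) `\` base_set z) `|` clash x y `|`
      (luzin_sys setT y `&` base_set x) `|` (luzin_sys setT x `&` base_set y)).
    by rewrite !finite_setU.
  apply: sub_finite_set => q [[[Ax|gx] [Ay|gy]] nz].
  - by do 3 left; split=> // h; apply: nz; left.
  - by left; right.
  - by right.
  - left; left; right; move: gx gy => [u [Yu _ ux Lu]] [v [Yv _ vy Lv]].
    exists u, v; split=> // uv; subst v; apply: nz; right; exists u; split=> //.
    by apply/hz.
have [zx zy] : le z x /\ le z y by apply/hz.
have : finite_set ((luzin_set z `\` luzin_set x) `|` (luzin_set z `\` luzin_set y)).
  by rewrite finite_setU; split; exact: luzin_set_subE.
apply: sub_finite_set => q [Az nA].
have [Ax|nAx] := pselect (luzin_set x q); last by left.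
by right; split=> // Ay; apply: nA.
Qed.

Lemma luzin_set_le x y : le x y <-> subE (luzin_set x) (luzin_set y).
Proof.
split=> [|h]; first exact: luzin_set_subE.
apply/base_set_le.
have : finite_set ((luzin_set x `\` luzin_set y) `|` (luzin_sys setT y `&` base_set x)).
  by rewrite finite_setU; split=> //; exact: finite_luzin_sys_base_set.
apply: sub_finite_set => q [Ax nAy].
have [gy|ngy] := pselect (luzin_sys setT y q); first by right.
by left; split; [left|case].
Qed.

Lemma luzin_sys_coherent V x y : le y x ->
  eqE (luzin_sys V x `&` luzin_set y) (luzin_sys V y).
Proof.
move=> yx; split; last first.
  apply: sub_finite_set (finite_set0 _) => q [h]; apply.
  by split; [exact: luzin_sys_le yx _ h|exact: luzin_sys_sub h].
have : finite_set ((luzin_sys V x `&` base_set y) `|` clash x y).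
  by rewrite finite_setU; split; [exact: finite_luzin_sys_base_set|exact: finite_clash].
apply: sub_finite_set => q [[gx [Ay|gy]] ng]; first by left.
right; move: gx gy => [u [Yu Vu ux Lu]] [v [Yv _ vy Lv]].
by exists u, v; split=> // uv; subst v; apply: ng; exists u.
Qed.

(** For [z] in [V] minus [V'], [C] would almost contain [piece z] and be almost disjoint from
    [base_set z]. One level [n] serves for uncountably many [z], and two of them, [y] and [z], share
    a point above that level. *)
Lemma luzin_sys_nontrivial V V' C : V `\` V' `<=` Y -> ~ countable (V `\` V') ->
  ~ forall x, eqE (C `&` luzin_set x) (symdiff (luzin_sys V x) (luzin_sys V' x)).
Proof.
move=> VY nV hC.
pose Q z n := [/\ forall m k, n <= m -> piece z (pt m k) -> C (pt m k),
  forall m k, n <= m -> C (pt m k) -> ~ base_set z (pt m k) & R n z (delta z)].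
have [z [Vz nV'z]|n nZ] := uncountable_pigeonhole (Q := Q) nV.
  have Yz : Y z by exact: VY.
  have [hC1 hC2] := hC z.
  have /subE_layer[N1 h1] : subE (piece z) C.
    have : finite_set (clash z z `|`
        (symdiff (luzin_sys V z) (luzin_sys V' z) `\` (C `&` luzin_set z))).
      by rewrite finite_setU; split=> //; exact: finite_clash.
    (* A point of [piece z] in the system of [V'] also lies in a piece of another index, as [z] is
       not in [V']. *)
    apply: sub_finite_set => q [Lq nCq].
    have [[u [Yu Vu uz Lu]]|ng] := pselect (luzin_sys V' z q).
      by left; exists z, u; split=> // e; apply: nV'z; rewrite e.
    right; split; last by case.
    by left; split=> //; exists z.
  have /subE_layer[N2 h2] : subE (C `&` base_set z) set0.
    have : finite_set (((C `&` luzin_set z) `\`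
        symdiff (luzin_sys V z) (luzin_sys V' z)) `|`
        (luzin_sys V z `&` base_set z) `|` (luzin_sys V' z `&` base_set z)).
      by rewrite !finite_setU; split; [split=> //|]; exact: finite_luzin_sys_base_set.
    apply: sub_finite_set => q [[Cq Aq] _].
    have [g|ng] := pselect (luzin_sys V z q); first by left; right.
    have [g'|ng'] := pselect (luzin_sys V' z q); first by right.
    by left; left; split; [split=> //; left|move=> [[]|[]]].
  have [N3 h3] := Rex (deltaP (le_refl z)).
  exists (maxn N1 (maxn N2 N3)); split.
  - by move=> m k; rewrite geq_max => /andP[/h1 h _]; exact: h.
  - move=> m k; rewrite !geq_max => /and3P[_ N2m _] Cp Ap.
    by have := h2 m k N2m (conj Cp Ap).
  - by apply: Rmono h3; rewrite !leq_max leqnn !orbT.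
have [z [[[Vz nV'z] [hL _ _]] zinf]] := uncountable_infinite_initial W1 nZ.
have [y [[[[Vy nV'y] [_ hA Ry]] yz] nRy]] := infinite_ex_notin zinf (Rfin n z).
(* [y] was picked outside the finite set of [R n]-predecessors of [z], which forces its point in
   [piece z] above level [n]. *)
have nphi : n <= phi y z.
  by rewrite leqNgt; apply/negP => /ltnW h; apply: nRy; exact: Rmono h (phiR yz).
apply: (hA _ (c (phi y z) y) nphi).
  by apply: hL => //; exists y; split=> //; exact: VY.
by exists (phi y z), y; split=> //; exact: Rmono nphi Ry.
Qed.

End Luzin.

End Semilattice.

Lemma injective_unbounded (f : nat -> nat) N : injective f -> exists j, N <= f j.
Proof.
move=> fi; have : infinite_set (range f).
  by rewrite (eq_finite_set (inj_card_eq (in2W fi))); exact: infinite_nat.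
move=> /infinite_ex_notin/(_ (finite_II N))[_ [[j _ <-] /negP]].
by rewrite -leqNgt; exists j.
Qed.

Lemma semilattice_family W (lt le : W -> W -> Prop) :
  is_omega1 lt -> partial_order le ->
  (forall x, countable [set y | strict le y x]) ->
  exists (A : W -> set nat) (U : set W) (g : set W -> W -> set nat),
  [/\ ~ countable U,
      forall x y, le x y <-> subE (A x) (A y),
      forall x y z, (forall w, le w z <-> le w x /\ le w y) ->
        eqE (A x `&` A y) (A z),
      forall V, (forall x, g V x `<=` A x) /\
        forall x y, le y x -> eqE (g V x `&` A y) (g V y)
    & forall V V' C, V `\` V' `<=` U -> ~ countable (V `\` V') ->
        ~ forall x, eqE (C `&` A x) (symdiff (g V x) (g V' x))].
Proof.
move=> W1 leP lec.
have [R Rf] := forests_exist W1; have [c c_inj] := forests_height W1 Rf.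
have /choice[delta deltaP] : forall x, exists d, forall y, le y x -> leo lt y d.
  move=> x; apply: (countable_bounded W1 (A := [set y | le y x])).
  apply: sub_countable (countable_setU (countable1 x) (lec x)).
  apply: subset_card_le => y yx.
  by have [->|yx'] := pselect (y = x); [left|right].
have [[U [nU hU]]|hN] := pselect (exists U : set W, ~ countable U /\
    forall Z, Z `<=` U -> ~ countable Z ->
    exists x, infinite_set [set y | Z y /\ le y x]).
  exists (base_set le R c delta), U, (rho_sys le R c delta); split=> //.
  - exact: (base_set_le W1 leP Rf c_inj deltaP).
  - exact: (base_set_meet W1 Rf c_inj deltaP).
  - move=> V; split; first by move=> x; exact: rho_sys_sub.
    exact: (rho_sys_coherent W1 leP Rf c_inj deltaP).
  - by move=> V V' C; exact: (rho_sys_nontrivial leP Rf c_inj deltaP hU).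
have [Y [nY Yfin]] : exists Y : set W, ~ countable Y /\
    forall x, finite_set [set y | Y y /\ le y x].
  (* In particular [W] itself is no such [U], and an uncountable set witnessing this is the required
     [Y]. *)
  apply: contrapT => h; apply: hN; exists setT; split.
    exact: (omega1_uncountable W1).
  move=> Z _ nZ; apply: contrapT => h'; apply: h; exists Z; split=> // x.
  by apply: contrapT => h''; apply: h'; exists x.
(* The codes of the pairs [(j, c j z)] are unbounded as [j] varies, so one of them is a level at
   which [y] already lies below [z]. The value 0 is a dummy. *)
have /choice[phi phiP] : forall yz : W * W, exists m, lt yz.1 yz.2 ->
    R m yz.1 yz.2 /\ exists j, m = pt j (c j yz.2).
  move=> [y z] /=; have [yz|] := pselect (lt y z); last by exists 0.
  have [_ [Rmono /(_ y z (or_intror yz))[N RN]] _ _ _] := Rf.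
  have [|j Nj] := @injective_unbounded (fun j => pt j (c j z)) N.
    by move=> i j /pt_inj[].
  by exists (pt j (c j z)) => _; split; [exact: Rmono Nj RN|exists j].
pose ph y z := phi (y, z).
have phR y z : lt y z -> R (ph y z) y z by move=> /(phiP (y, z))[].
have phM y z : lt y z -> exists j, ph y z = pt j (c j z) by move=> /(phiP (y, z))[].
exists (luzin_set lt le R c delta Y ph), Y, (luzin_sys lt le c Y ph); split=> //.
- exact: (luzin_set_le W1 leP Rf c_inj deltaP Yfin phR).
- exact: (luzin_set_meet W1 leP Rf c_inj deltaP Yfin phR phM).
- move=> V; split; first by move=> x; exact: luzin_sys_sub.
  exact: (luzin_sys_coherent W1 leP Rf c_inj deltaP Yfin phR phM).
- by move=> V V' C; exact: (luzin_sys_nontrivial W1 leP Rf c_inj deltaP Yfin phR phM).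
Qed.

(** * The gap cohomology group *)

Lemma symdiff_self (A : set nat) : symdiff A A = set0.
Proof. by apply/seteqP; split=> // q [] []. Qed.

Lemma coset_of_eq T (g h : subsys T) : coherent h ->
  coset_of g = coset_of h -> trivial_sys (sys_mul g h).
Proof.
move=> ch e; suff [] : coset_of g h by [].
rewrite e; split=> //; exists set0 => A.
by rewrite set0I /sys_mul symdiff_self; split; rewrite /subE setDv;
  exact: finite_set0.
Qed.

(** The upper bound: a class is determined by a chosen representative, which amounts to a subset of
    [memT T] times omega and so to a subset of [W]. *)
Lemma GT_inj T W (lt : W -> W -> Prop) (j : memT T -> W) :
  is_omega1 lt -> injective j -> exists F : GT T -> W -> bool, injective F.
Proof.
move=> W1 ji; have [q qi] := omega1_prod_nat W1.
have /choice[rep repP] : forall S : GT T, exists g,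
    coherent g /\ sval S = coset_of g by move=> [S].
pose F (S : GT T) w := `[< exists A n, w = q (j A, n) /\ rep S A n >].
exists F => S S' e.
have rr : rep S = rep S'.
  apply: funext => A; apply/seteqP; split=> n hn.
    have : F S (q (j A, n)) by apply/asboolP; exists A, n.
    by rewrite e => /asboolP[A' [n' [/qi[/ji <- <-]]]].
  have : F S' (q (j A, n)) by apply/asboolP; exists A, n.
  by rewrite -e => /asboolP[A' [n' [/qi[/ji <- <-]]]].
have ss : sval S = sval S' by rewrite (repP S).2 rr -(repP S').2.
by move: S S' ss {e rr} => [S hS] [S' hS'] /= ss; subst S'; congr exist;
  exact: Prop_irrelevance.
Qed.

Lemma omega1_semilattice W (lt le : W -> W -> Prop) :
  is_omega1 lt -> lower_semilattice le ->
  (forall x, countable [set y | strict le y x]) ->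
  exists T : set (set nat), star_lsl T /\ order_iso_to le T /\
    (forall (W' : Type) (lt' : W' -> W' -> Prop), is_omega1 lt' ->
       exists f : GT T -> (W' -> bool), bijective f).
Proof.
move=> W1 [leP meet] lec.
have [A [U [g [nU Ale Ameet gP gN]]]] := semilattice_family W1 leP lec.
have [le_refl [le_anti le_trans]] := leP.
pose T := range A.
pose f x : memT T := exist _ (A x) (imageT A x).
have fi : injective f.
  move=> x y /(congr1 sval) /= e.
  by apply: le_anti; apply/Ale; rewrite e; rewrite -?e; apply/Ale.
have fb : bijective f.
  apply: inj_surj_bijective fi _ => -[B hB]; have [x _ e] := hB; exists x.
  by subst B; congr exist; exact: Prop_irrelevance.
exists T; split=> [B C [x _ <-] [y _ <-]|].
  have [z [zx [zy zP]]] := meet x y; exists (A z); split; first exact: imageT.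
  apply: Ameet => w; split=> [wz|[wx wy]]; last exact: zP.
  by split; exact: le_trans wz _.
split=> [|W' lt' W1']; first by exists f; split=> // x y; exact: Ale.
have [k fK kK] := fb.
pose gs V : subsys T := fun B => g V (k B).
have kA B : A (k B) = sval B by rewrite -[in RHS](kK B).
have gsC V : coherent (gs V).
  split=> [B|B C]; rewrite /gs -!kA; first by have [h _] := gP V; exact: h.
  by move=> /Ale CB; have [_ h] := gP V; exact: h.
have [D [DU nD dD]] := uncountable_partition W1 W1' nU.
(* If [s] holds at [w] and [s'] does not, then [V s] minus [V s'] contains the whole row [D w],
   because the rows are disjoint. *)
pose V (s : W' -> bool) := \bigcup_(w in [set w | s w]) D w.
have VD (s s' : W' -> bool) w : s w -> ~~ s' w -> ~ countable (V s `\` V s').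
  move=> sw s'w; apply: uncountable_sub (nD w) => x Dx; split; first by exists w.
  by move=> [v /= s'v Dv]; move: s'w; rewrite (dD _ _ _ Dx Dv) s'v.
have VU s s' : V s `\` V s' `<=` U by move=> x [[w _ /DU]].
have nontriv (s s' : W' -> bool) w : s w -> ~~ s' w ->
    ~ trivial_sys (sys_mul (gs (V s)) (gs (V s'))).
  move=> sw s'w [C hC]; apply: (gN _ _ C (VU s s') (VD _ _ _ sw s'w)) => x.
  by have := hC (f x); rewrite /sys_mul /gs fK.
pose G (s : W' -> bool) : GT T :=
  exist _ (coset_of (gs (V s))) (ex_intro _ _ (conj (gsC _) erefl)).
have Gi : injective G.
  move=> s s' /(congr1 sval) /= e; apply: funext => w.
  case sw: (s w); case s'w: (s' w) => //; exfalso.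
    by apply: (nontriv s s' w _ _ (coset_of_eq (gsC _) e)); rewrite ?sw ?s'w.
  by apply: (nontriv s' s w _ _ (coset_of_eq (gsC _) (esym e))); rewrite ?sw ?s'w.
have [j [ji _]] := omega1_inj W1 (omega1_uncountable W1').
have [F Fi] : exists F : GT T -> W' -> bool, injective F.
  apply: (GT_inj W1' (j := j \o k)); apply: inj_comp ji _.
  exact: can_inj kK.
exact: Cantor_Bernstein_bij Fi Gi.
Qed.

Theorem mainTheorem7 (X : Type) (le : X -> X -> Prop) :
  lower_semilattice le -> omega1_like le ->
  exists T : set (set nat),
    star_lsl T /\ order_iso_to le T /\
    (* |G(T)| = 2^omega_1 *)
    (forall (W : Type) (lt : W -> W -> Prop), is_omega1 lt ->
       exists f : GT T -> (W -> bool), bijective f).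
Proof.
move=> [[le_refl [le_anti le_trans]] meet] [_ [[W [lt [f [W1 fb]]]] lec]].
have [k fK kK] := fb.
(* The semi-lattice is copied onto [W], so that one set carries both orders. *)
pose le' a b := le (k a) (k b).
have [||T [lsl [[h [hb hP]] card]]] := @omega1_semilattice W lt le' W1.
- split=> [|a b].
    split=> [a|]; first exact: le_refl.
    split=> [a b ab ba|a b c]; last exact: le_trans.
    by apply: (can_inj kK); exact: le_anti.
  have [m [ma [mb mP]]] := meet (k a) (k b).
  by exists (f m); rewrite /le' fK; split=> //; split=> // c; exact: mP.
- move=> a; apply: sub_countable (countable_image f (lec (k a))).
  apply: subset_card_le => b [ba nba]; exists (k b) => //.
  by split=> // e; apply: nba; exact: can_inj kK _ _ e.
exists T; split=> //; split=> //; exists (h \o f).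
by split=> [|x y]; [exact: bij_comp|rewrite -hP /le' !fK].
Qed.
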